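(* Let $F(\omega,\varphi)\ge 0$ be a nonnegative function defined on the set of flags $\{(\omega,\varphi):\omega\in\mathbf{S}^2,\ \varphi\in\mathbf{S}_\omega\}$. Consider the equation $$H_\omega(\varphi)+[H_\omega(\varphi)]''_{\varphi\varphi}=F(\omega,\varphi)\quad\text{for every }\omega\in\mathbf{S}^2\text{ and }\varphi\in\mathbf{S}_\omega. \qquad( * )$$ If $( * )$ has a spherical solution $H(\Omega)$, $\Omega\in\mathbf{S}^2$, then there exists a convex body $B\subset\mathbb{R}^3$ whose projection curvature radius function is $F(\omega,\varphi)$ and whose support function is $H(\Omega)$. Moreover, every spherical solution of $( * )$ has the form $H(\Omega)+\langle a,\Omega\rangle$ with $a\in\mathbb{R}^3$, and each such function is the support function of the translate of $B$ by the vector $a$.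
   Context: $\mathbf{S}^2$ is the unit sphere in $\mathbb{R}^3$; for $\omega\in\mathbf{S}^2$, $\mathbf{S}_\omega\subset\mathbf{S}^2$ is the great circle with pole $\omega$ (the unit vectors orthogonal to $\omega$), parametrized by angle. A flag is a pair $(\omega,\varphi)$ with $\omega\in\mathbf{S}^2$, $\varphi\in\mathbf{S}_\omega$. For a function $H$ on $\mathbf{S}^2$, $H_\omega$ denotes its restriction to $\mathbf{S}_\omega$, and $[H_\omega(\varphi)]''_{\varphi\varphi}$ is its second derivative with respect to the angle along $\mathbf{S}_\omega$. A function $H\in C^2(\mathbf{S}^2)$ whose restrictions satisfy $( * )$ is called a spherical solution of $( * )$. The support function of a convex body $B\subset\mathbb{R}^3$ is $H(\Omega)=\max\{\langle\Omega,y\rangle:y\in B\}$, $\Omega\in\mathbf{S}^2$, where $\langle\cdot,\cdot\rangle$ is the standard inner product. Projection curvature radius function of $B$: $B(\omega)$ is the orthogonal projection of $B$ onto the plane through the origin orthogonal to $\omega$, and $R(\omega,\varphi)$ is the curvature radius of the planar curve $\partial B(\omega)$ at the point whose outer normal direction is $\varphi\in\mathbf{S}_\omega$. (For a planar convex body with $C^2$ support function $h$, the curvature radius at the point with normal $\varphi$ is $h(\varphi)+h''(\varphi)$.) *)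

(* Defs.v *)
From HB Require Import structures.
From mathcomp Require Import all_boot all_order all_algebra.
From mathcomp Require Import all_classical all_reals all_analysis.
From mathcomp Require Import ring lra.

Set Implicit Arguments.
Unset Strict Implicit.
Unset Printing Implicit Defensive.

Import Order.TTheory GRing.Theory Num.Theory.
Import numFieldNormedType.Exports.

Local Open Scope classical_set_scope.
Local Open Scope ring_scope.

Section Definitions.
Context {R : realType}.
Implicit Types (u v w x y a omega phi : 'rV[R]_3).
Implicit Types (A B K : set 'rV[R]_3) (F : 'rV[R]_3 -> 'rV[R]_3 -> R).

(* The norm `|_| of the library on 'rV[R]_3 is the sup norm (it induces the
   usual topology), so Euclidean notions are expressed through [dot]. *)
Definition dot u v : R := \sum_(i < 3) u 0 i * v 0 i.

Definition cross u v : 'rV[R]_3 :=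
  \row_(i < 3) (u 0 (i + 1) * v 0 (i + 2) - u 0 (i + 2) * v 0 (i + 1)).

Definition sphere : set 'rV[R]_3 := [set u | dot u u = 1].

Definition great_circle omega : set 'rV[R]_3 :=
  [set u | sphere u /\ dot omega u = 0].

Definition flag omega phi : Prop := sphere omega /\ great_circle omega phi.

(* The point of the great circle with pole omega at angle t from phi, for the
   orientation induced by omega. *)
Definition circle_pt omega phi (t : R) : 'rV[R]_3 :=
  cos t *: phi + sin t *: cross omega phi.

(* G is C^2 on U: it is twice Frechet differentiable at every point of U and
   its second derivative is continuous on U. *)
Definition C2_on (U : set 'rV[R]_3) (G : 'rV[R]_3 -> R) : Prop :=
  [/\ forall x, U x -> differentiable G x,
      forall v x, U x -> differentiable ('D_v G) x &
      forall v w x, U x -> {for x, continuous ('D_w ('D_v G))}].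

(* C^2 on the submanifold S^2 of R^3: locally, the restriction of a C^2
   function of the ambient space.  Values outside the sphere are irrelevant. *)
Definition C2_sphere (H : 'rV[R]_3 -> R) : Prop :=
  forall omega, sphere omega ->
  exists (U : set 'rV[R]_3) (G : 'rV[R]_3 -> R),
    [/\ open U, U omega, C2_on U G &
        forall x, U x -> sphere x -> H x = G x].

Definition spherical_solution F (H : 'rV[R]_3 -> R) : Prop :=
  C2_sphere H /\
  forall omega phi, flag omega phi ->
    H phi + derive1n 2 (fun t : R => H (circle_pt omega phi t)) 0 = F omega phi.

(* No interior is required: F = 0 is allowed, and then B is a point. *)
Definition convex_body B : Prop :=
  [/\ B !=set0, compact B & convex_set B].

Definition is_support_function B (H : 'rV[R]_3 -> R) : Prop :=
  forall Omega, sphere Omega ->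
    [set dot Omega y | y in B] (H Omega) /\
    ubound [set dot Omega y | y in B] (H Omega).

Definition translate a B : set 'rV[R]_3 := [set y + a | y in B].

Definition proj omega y : 'rV[R]_3 := y - dot omega y *: omega.

Definition projection omega B : set 'rV[R]_3 := proj omega @` B.

Definition support_set K u : set 'rV[R]_3 :=
  [set x | K x /\ forall y, K y -> dot u y <= dot u x].

(* For a convex set K of the plane omega^perp, r is the curvature radius ds/dt
   of the boundary of K at the point with outer normal phi: for t near 0, K
   has a unique boundary point x t whose outer normal is at angle t from phi,
   and x'(0) = r * (unit tangent), the unit tangent being the normal phi turned
   by a right angle. *)
Definition is_curvature_radius omega K phi (r : R) : Prop :=
  exists2 x : R -> 'rV[R]_3,
    \forall t \near (0 : R), support_set K (circle_pt omega phi t) = [set x t] &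
    is_derive (0 : R) (1 : R) x (r *: cross omega phi).

Definition is_projection_curvature_radius B F : Prop :=
  forall omega phi, flag omega phi ->
    is_curvature_radius omega (projection omega B) phi (F omega phi).

End Definitions.

Section CurvatureRadius.
Context {R : realType}.
Implicit Types (u v w x y a omega phi : 'rV[R]_3).

Lemma dotE u v :
  dot u v = u 0 0 * v 0 0 + u 0 1 * v 0 1 + u 0 (1 + 1) * v 0 (1 + 1).
Proof.
rewrite /dot !big_ord_recr big_ord0 /= add0r.
by congr (u 0 _ * v 0 _ + u 0 _ * v 0 _ + u 0 _ * v 0 _); apply/val_inj.
Qed.

Lemma dot_circle_pt omega phi y (t : R) :
  dot (circle_pt omega phi t) y
    = cos t * dot phi y + sin t * dot (cross omega phi) y.
Proof. by rewrite !dotE !mxE; ring. Qed.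

Lemma crossE u v :
  (cross u v 0 0 = u 0 1 * v 0 (1 + 1) - u 0 (1 + 1) * v 0 1) *
  (cross u v 0 1 = u 0 (1 + 1) * v 0 0 - u 0 0 * v 0 (1 + 1)) *
  (cross u v 0 (1 + 1) = u 0 0 * v 0 1 - u 0 1 * v 0 0).
Proof.
by do ![split]; rewrite mxE; congr (u 0 _ * v 0 _ - u 0 _ * v 0 _);
  apply/val_inj.
Qed.

Lemma eq_rV3 u v :
  u 0 0 = v 0 0 -> u 0 1 = v 0 1 -> u 0 (1 + 1) = v 0 (1 + 1) -> u = v.
Proof.
move=> e0 e1 e2; apply/rowP => -[[|[|[|//]]] i3].
- by rewrite (_ : Ordinal i3 = 0) //; apply/val_inj.
- by rewrite (_ : Ordinal i3 = 1) //; apply/val_inj.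
- by rewrite (_ : Ordinal i3 = 1 + 1) //; apply/val_inj.
Qed.

Lemma flag_decomposition omega phi y : flag omega phi -> dot omega y = 0 ->
  y = dot phi y *: phi + dot (cross omega phi) y *: cross omega phi.
Proof.
move=> [so [sp op]] oy; set c := cross omega phi.
have key (i : 'I_3) : i \in [:: 0; 1; 1 + 1] ->
  y 0 i * (dot omega omega * dot phi phi - dot omega phi ^+ 2) =
  dot omega y * cross phi c 0 i
  + dot phi y * (dot omega omega * phi 0 i - dot omega phi * omega 0 i)
  + dot c y * c 0 i.
  rewrite !inE => /or3P[] /eqP ->; rewrite /c !(dotE, crossE); ring.
have key1 (i : 'I_3) : i \in [:: 0; 1; 1 + 1] ->
    y 0 i = (dot phi y *: phi + dot c y *: c) 0 i.
  move=> /key; move: so sp => /= -> ->.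
  by rewrite op oy expr0n /= subr0 !mul1r !mul0r subr0 mulr1 add0r !mxE.
by apply: eq_rV3; apply: key1; rewrite !inE eqxx ?orbT.
Qed.

Lemma flag_cross omega phi : flag omega phi ->
  [/\ dot (cross omega phi) (cross omega phi) = 1,
      dot phi (cross omega phi) = 0 & dot omega (cross omega phi) = 0].
Proof.
move=> [so [sp op]]; split.
- have -> : dot (cross omega phi) (cross omega phi) =
      dot omega omega * dot phi phi - dot omega phi ^+ 2.
    by rewrite !(dotE, crossE); ring.
  by rewrite so sp op; ring.
- by rewrite !(dotE, crossE); ring.
- by rewrite !(dotE, crossE); ring.
Qed.

Lemma dotZDr u v w (k l : R) : dot u (k *: v + l *: w) = k * dot u v + l * dot u w.
Proof. by rewrite !dotE !mxE; ring. Qed.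

(* If K has support function h along its normals, with h twice differentiable,
   then its curvature radius is h + h''. *)
Lemma curvature_radius_support omega phi (K : set 'rV[R]_3) (h : R -> R) :
  flag omega phi ->
  (forall y, K y -> dot omega y = 0) ->
  (forall t, [set dot (circle_pt omega phi t) y | y in K] (h t) /\
     ubound [set dot (circle_pt omega phi t) y | y in K] (h t)) ->
  (forall t, derivable h t 1) -> derivable (derive1 h) (0 : R) 1 ->
  is_curvature_radius omega K phi (h 0 + derive1n 2 h 0).
Proof.
move=> fl K0 hK dh d2h.
pose c := cross omega phi.
pose x t : 'rV[R]_3 := (h t * cos t - derive1 h t * sin t) *: phi
                     + (h t * sin t + derive1 h t * cos t) *: c.
have cs t : cos t ^+ 2 + sin t ^+ 2 = 1 :> R by rewrite cos2Dsin2.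
have touch t y : K y -> dot (circle_pt omega phi t) y = h t -> y = x t.
  move=> Ky yt.
  pose g s := h s - (cos s * dot phi y + sin s * dot c y).
  have dg s : is_derive s (1 : R) g
      (derive1 h s - (- sin s * dot phi y + cos s * dot c y)).
    have := derivableP (dh s); rewrite -derive1E => dhs.
    have -> : g = h - ((cos : R -> R) * cst (dot phi y) + (sin : R -> R) * cst (dot c y)) by [].
    by apply: is_derive_eq; rewrite /= !scaler0 /GRing.scale /=; ring.
  have g0 s : 0 <= g s.
    have [_ ub] := hK s; rewrite /g subr_ge0 -dot_circle_pt.
    by apply: ub; exists y.
  have gt : g t = 0 by rewrite /g -dot_circle_pt yt subrr.
  have : is_derive t 1 g 0.
    apply: (@derive1_at_min _ g (t - 1) (t + 1)); first lra.
    - by move=> s _; apply: ex_derive; exact: dg.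
    - by rewrite in_itv /=; apply/andP; split; lra.
    - by move=> s _; rewrite gt.
  case=> _; case: (dg t) => _ -> h't.
  rewrite dot_circle_pt in yt.
  rewrite [LHS](flag_decomposition fl (K0 _ Ky)) /x -yt.
  have -> : derive1 h t = - sin t * dot phi y + cos t * dot c y by lra.
  congr (_ *: _ + _ *: _).
  - by rewrite -[LHS]mulr1 -(cs t); rewrite /c; ring.
  - by rewrite -[LHS]mulr1 -(cs t); rewrite /c; ring.
exists x.
  near=> t; apply/seteqP; split => [y [Ky yK]|_ ->] /=.
  - apply: touch => //; have [[z Kz zt] ub] := hK t.
    by apply/eqP; rewrite eq_le -{2}zt yK // andbT; apply: ub; exists y.
  - have [[z Kz zt] ub] := hK t; rewrite -(touch t z) //; split => // y Ky.
    by rewrite zt; apply: ub; exists y.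
have dhE : is_derive (0 : R) 1 h (derive1 h 0).
  by rewrite derive1E; apply: derivableP.
have d2hE : is_derive (0 : R) 1 (derive1 h) (derive1n 2 h 0).
  by rewrite /derive1n /= derive1E; apply: derivableP.
have dxi i j : is_derive (0 : R) 1 (fun t => x t i j)
    (((h 0 + derive1n 2 h 0) *: c) i j).
  have -> : (fun t => x t i j) =
      (h * cos - derive1 h * sin) * cst (phi i j)
      + (h * sin + derive1 h * cos) * cst (c i j).
    by apply/funext => t; rewrite !mxE.
  apply: is_derive_eq; rewrite !mxE /= sin0 cos0 !scaler0 /GRing.scale /=; ring.
have dx : derivable x 0 1 by apply/derivable_mxP => i j; apply: ex_derive; apply: dxi.
apply: DeriveDef => //; rewrite derive_mx //; apply/matrixP => i j; rewrite mxE.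
by case: (dxi i j).
Unshelve. all: by end_near. Qed.

Lemma is_curvature_radius_unique omega phi (K : set 'rV[R]_3) (r s : R) :
  flag omega phi -> is_curvature_radius omega K phi r ->
  is_curvature_radius omega K phi s -> r = s.
Proof.
move=> fl [x Kx dx] [y Ky dy].
have dy' : is_derive (0 : R) (1 : R) x (s *: cross omega phi).
  apply: near_eq_is_derive dy; near=> t.
  have xt : support_set K (circle_pt omega phi t) = [set x t] by near: t.
  have yt : support_set K (circle_pt omega phi t) = [set y t] by near: t.
  have : [set x t] (y t) by rewrite -xt yt.
  by [].
case: dx => _ dx; case: dy' => _; rewrite dx => {dx}.
have [cc _ _] := flag_cross fl; move=> /(congr1 (dot (cross omega phi))).
have Z k u v : dot u (k *: v) = k * dot u v by rewrite !dotE !mxE; ring.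
by rewrite !Z cc !mulr1.
Unshelve. all: by end_near. Qed.

End CurvatureRadius.

(* Main.v *)
(* For a fixed direction u, the tangent vector y = H(u) u + grad H(u) satisfies
   <y, u> = H(u) and agrees to first order with H at u along every great
   circle through u.  Along such a circle h + h'' = F >= 0, so Sturm comparison
   with the solution t |-> <y, u(t)> of f + f'' = 0 gives <y, v> <= H(v) for all
   v on the half circle, hence on the whole sphere.  Thus the intersection B of
   the half-spaces {<., v> <= H(v)} touches each of its defining planes, i.e.
   it has support function H.  The same comparison applied to G - H and to
   H - G, for two solutions G and H, shows that G - H is linear. *)
Require Import Defs.
From HB Require Import structures.
From mathcomp Require Import all_boot all_order all_algebra.
From mathcomp Require Import all_classical all_reals all_analysis.
From mathcomp Require Import ring lra.
Import Order.TTheory GRing.Theory Num.Theory.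
Import numFieldNormedType.Exports.
Local Open Scope classical_set_scope.
Local Open Scope ring_scope.

(** * Rotation along great circles *)

Lemma dotC {R : realType} (u v : 'rV[R]_3) : dot u v = dot v u.
Proof. by rewrite !dotE; ring. Qed.

Lemma dotDr {R : realType} (u v w : 'rV[R]_3) : dot u (v + w) = dot u v + dot u w.
Proof. by rewrite !dotE !mxE; ring. Qed.

Lemma dotZr {R : realType} (u v : 'rV[R]_3) (k : R) : dot u (k *: v) = k * dot u v.
Proof. by rewrite !dotE !mxE; ring. Qed.

Lemma dotBr {R : realType} (u v w : 'rV[R]_3) : dot u (v - w) = dot u v - dot u w.
Proof. by rewrite !dotE !mxE; ring. Qed.

Lemma circle_pt0 {R : realType} (omega phi : 'rV[R]_3) : circle_pt omega phi 0 = phi.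
Proof. by rewrite /circle_pt cos0 sin0 scale1r scale0r addr0. Qed.

Lemma circle_pt_flag {R : realType} {omega phi : 'rV[R]_3} (t : R) :
  flag omega phi -> flag omega (circle_pt omega phi t).
Proof.
move=> fl; have [cc pc oc] := flag_cross fl; case: fl => [so [sp op]].
split=> //; split; last by rewrite dotZDr op oc !mulr0 addr0.
rewrite /sphere /= dot_circle_pt (dotC phi) (dotC (cross _ _)) !dot_circle_pt.
rewrite cc sp (dotC (cross _ _)) pc -[RHS](cos2Dsin2 t); ring.
Qed.

Lemma cross_circle_pt {R : realType} {omega phi : 'rV[R]_3} (t : R) :
  flag omega phi ->
  cross omega (circle_pt omega phi t) = cos t *: cross omega phi - sin t *: phi.
Proof.
(* The second summand is the triple product expansion of [cross omega (cross omega phi)]. *)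
have -> : cross omega (circle_pt omega phi t) = cos t *: cross omega phi
    + sin t *: (dot omega phi *: omega - dot omega omega *: phi).
  by apply: eq_rV3; rewrite !(dotE, crossE, mxE); ring.
by move=> [-> [_ ->]]; rewrite scale0r scale1r sub0r scalerN.
Qed.

(** For a fixed pole, [circle_pt] is rotation about [omega], so angles add. This lets any point of
    the circle serve as origin of the angle. *)
Lemma circle_ptD {R : realType} {omega phi : 'rV[R]_3} (s t : R) :
  flag omega phi ->
  circle_pt omega (circle_pt omega phi s) t = circle_pt omega phi (s + t).
Proof.
move=> fl; rewrite {1}/circle_pt (cross_circle_pt s fl) /circle_pt cosD sinD.
by apply: eq_rV3; rewrite !mxE; ring.
Qed.

(** * Derivatives along great circles and Sturm comparison *)

Lemma is_derive_circle_pt {R : realType} (omega phi : 'rV[R]_3) (t : R) :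
  is_derive t 1 (circle_pt omega phi) (cos t *: cross omega phi - sin t *: phi).
Proof.
have dij i j : is_derive t (1 : R) (fun s => circle_pt omega phi s i j)
    ((cos t *: cross omega phi - sin t *: phi) i j).
  have -> : (fun s => circle_pt omega phi s i j) =
      (cos : R -> R) * cst (phi i j) + (sin : R -> R) * cst (cross omega phi i j).
    by apply/funext => s; rewrite !mxE.
  have := is_deriveD (is_deriveM (is_derive_cos t) (is_derive_cst (phi i j) t 1))
    (is_deriveM (is_derive_sin t) (is_derive_cst (cross omega phi i j) t 1)).
  by move=> /is_derive_eq; apply; rewrite !mxE !scaler0 /GRing.scale /=; ring.
have d : derivable (circle_pt omega phi) t 1.
  by apply/derivable_mxP => i j; apply: ex_derive; apply: dij.
apply: DeriveDef => //; rewrite derive_mx //; apply/matrixP => i j; rewrite mxE.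
by case: (dij i j).
Qed.

Lemma is_derive_comp_circle_pt {R : realType} {omega phi : 'rV[R]_3}
    {G : 'rV[R]_3 -> R} {t : R} :
  differentiable G (circle_pt omega phi t) ->
  is_derive t 1 (G \o circle_pt omega phi)
    (cos t * 'D_(cross omega phi) G (circle_pt omega phi t)
     - sin t * 'D_phi G (circle_pt omega phi t)).
Proof.
move=> dG; case: (is_derive_circle_pt omega phi t) => dg g'.
have /derivable1_diffP dg' := dg.
apply: DeriveDef; first by apply/derivable1_diffP; apply: differentiable_comp.
rewrite deriveE; last exact: differentiable_comp.
rewrite diff_comp //= -(deriveE _ dg') g' !(deriveE _ dG).
by rewrite linearB !linearZ.
Qed.

(* [W s = f' s * sin (t - s) + f s * cos (t - s)] has derivative
   [(f s + f'' s) * sin (t - s) >= 0] on [[0, t]]. *)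
Lemma sturm_comparison {R : realType} (f : R -> R) (t : R) :
  (forall s, derivable f s 1) -> (forall s, derivable (derive1 f) s 1) ->
  (forall s, 0 <= f s + derive1n 2 f s) -> 0 <= t <= pi ->
  cos t * f 0 + sin t * derive1 f 0 <= f t.
Proof.
move=> df d2f f_ge0 /andP[t0 tpi].
pose W s := derive1 f s * sin (t - s) + f s * cos (t - s).
have dW s : is_derive s (1 : R) W ((f s + derive1n 2 f s) * sin (t - s)).
  have df' : is_derive s 1 f (derive1 f s) by rewrite derive1E; apply: derivableP.
  have d2f' : is_derive s 1 (derive1 f) (derive1n 2 f s).
    by rewrite /derive1n /= derive1E; apply: derivableP.
  pose r u : R := t - u.
  have dr : is_derive s (1 : R) r (-1).
    by apply: is_derive_eq; rewrite add0r mul1r.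
  have dsin := @is_derive1_comp _ sin r s _ _ (is_derive_sin (t - s)) dr.
  have dcos := @is_derive1_comp _ cos r s _ _ (is_derive_cos (t - s)) dr.
  have -> : W = derive1 f * (sin \o r) + f * (cos \o r) by [].
  have := is_deriveD (is_deriveM d2f' dsin) (is_deriveM df' dcos).
  by move=> /is_derive_eq; apply; rewrite /GRing.scale /r /=; ring.
have -> : cos t * f 0 + sin t * derive1 f 0 = W 0 by rewrite /W subr0; ring.
have -> : f t = W t by rewrite /W subrr sin0 cos0; ring.
apply: (@ger0_derive1_ndecr R W 0 t) => //.
- move=> s; rewrite in_itv /= => /andP[s0 st].
  rewrite derive1E; case: (dW s) => _ ->; apply: mulr_ge0 => //.
  by apply: sin_ge0_pi; lra.
- apply: derivable_within_continuous => s _; apply: ex_derive.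
Qed.

Lemma derive1_shift {R : realType} (f : R -> R) (a : R) :
  derive1 (fun s => f (a + s)) = fun s => derive1 f (a + s).
Proof.
apply/funext => s; rewrite /derive1.
rewrite [X in _ = lim (X @ _)](_ : _ =
  (fun h : R => h^-1 *: (f (a + (h + s)) - f (a + s)))) //.
by apply/funext => h; rewrite addrCA.
Qed.

Lemma derive_gradient {R : realType} {G : 'rV[R]_3 -> R} {x : 'rV[R]_3} :
  differentiable G x ->
  forall v, 'D_v G x = dot v (\row_i 'D_(delta_mx 0 i) G x).
Proof.
move=> dG v; rewrite deriveE // [v in LHS]row_sum_delta linear_sum /=.
by apply: eq_bigr => i _; rewrite linearZ mxE deriveE.
Qed.

Lemma near_circle_pt {R : realType} {U : set 'rV[R]_3} {omega phi : 'rV[R]_3} {t : R} :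
  open U -> U (circle_pt omega phi t) -> \forall s \near t, U (circle_pt omega phi s).
Proof.
move=> oU Ut; have ct : {for t, continuous (circle_pt omega phi)}.
  by apply/differentiable_continuous/derivable1_diffP; case: (is_derive_circle_pt omega phi t).
by apply: ct; apply: open_nbhs_nbhs.
Qed.

(** Near [t] the circle stays in [U] and on the sphere, where [H] and its local extension [G] agree;
    the chain rule for [G] then differentiates [H]. *)
Lemma is_derive_sphere_circle {R : realType} {H G : 'rV[R]_3 -> R}
    {U : set 'rV[R]_3} {omega phi : 'rV[R]_3} {t : R} :
  open U -> (forall x, U x -> differentiable G x) ->
  (forall x, U x -> sphere x -> H x = G x) ->
  flag omega phi -> U (circle_pt omega phi t) ->
  is_derive t 1 (fun s => H (circle_pt omega phi s))
    (cos t * 'D_(cross omega phi) G (circle_pt omega phi t)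
     - sin t * 'D_phi G (circle_pt omega phi t)).
Proof.
move=> oU dG HG fl Ut.
apply: near_eq_is_derive (is_derive_comp_circle_pt (dG _ Ut)).
apply: filterS (near_circle_pt oU Ut) => s Us /=.
by rewrite HG //; case: (circle_pt_flag s fl) => _ [].
Qed.

(** * Smoothness along circles and first-order contact *)

(** The only smoothness that the comparison uses; it passes to differences directly, with no gluing
    of local extensions. *)
Definition twice_derivable_circles {R : realType} (H : 'rV[R]_3 -> R) :=
  forall omega phi, flag omega phi -> forall t : R,
    derivable (fun s => H (circle_pt omega phi s)) t 1 /\
    derivable (derive1 (fun s => H (circle_pt omega phi s))) t 1.

(** First-order contact of [H] and the linear function of [y] at [Omega]. If [H] is a differentiable
    support function, [y] is the boundary point with outer normal [Omega]. *)
Definition tangent_vector {R : realType} (H : 'rV[R]_3 -> R) (Omega y : 'rV[R]_3) :=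
  dot Omega y = H Omega /\
  forall omega, flag omega Omega ->
    derive1 (fun t => H (circle_pt omega Omega t)) 0 = dot (cross omega Omega) y.

Lemma C2_sphere_circles {R : realType} {H : 'rV[R]_3 -> R} :
  C2_sphere H -> twice_derivable_circles H.
Proof.
move=> CH omega phi fl t.
have [_ [st _]] := circle_pt_flag t fl.
have [U [G [oU Ut [dG d2G _] HG]]] := CH _ st.
have dh s (Us : U (circle_pt omega phi s)) := is_derive_sphere_circle oU dG HG fl Us.
split; first by apply: ex_derive; apply: dh.
pose c := cross omega phi.
(* Near [t] the first derivative is this combination of directional derivatives of [G], which are
   themselves differentiable. *)
apply: (@near_eq_derivable _ _ _
  (cos * ('D_c G \o circle_pt omega phi) - sin * ('D_phi G \o circle_pt omega phi))).
  by apply: filterS (near_circle_pt oU Ut) => s /dh[_ dhs]; rewrite derive1E dhs.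
have d1 v : derivable ('D_v G \o circle_pt omega phi) t 1.
  by apply: ex_derive; apply: is_derive_comp_circle_pt (d2G v _ Ut).
by apply: derivableB; apply: derivableM => //; apply: ex_derive.
Qed.

Lemma C2_sphere_tangent {R : realType} {H : 'rV[R]_3 -> R} {Omega : 'rV[R]_3} :
  C2_sphere H -> sphere Omega -> exists y, tangent_vector H Omega y.
Proof.
move=> CH sO; have [U [G [oU UO [dG _ _] HG]]] := CH _ sO.
have DG := derive_gradient (dG _ UO).
set g := \row_i _ in DG.
(* The ambient gradient [g] has an arbitrary component along [Omega]. It is corrected to give the
   value [H Omega]; tangential derivatives do not change, since [Omega] is orthogonal to them. *)
exists (g + (H Omega - dot Omega g) *: Omega).
have OO : dot Omega Omega = 1 by [].
split=> [|omega fl]; first by rewrite dotDr dotZr OO; ring.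
have [_ Oc _] := flag_cross fl.
rewrite dotDr dotZr (dotC _ Omega) Oc mulr0 addr0 -DG.
have U0 : U (circle_pt omega Omega 0) by rewrite circle_pt0.
have [_] := is_derive_sphere_circle oU dG HG fl U0.
by rewrite derive1E circle_pt0 sin0 cos0 mul1r mul0r subr0.
Qed.

(** * The half great circle joining two points *)

(** The sign condition puts [v] on the half circle that starts at [u], where the angle lies in
    [[0, pi]] as Sturm comparison requires. *)
Lemma flag_through {R : realType} {u v : 'rV[R]_3} : sphere u -> sphere v ->
  exists omega, [/\ flag omega u, dot omega v = 0 & 0 <= dot (cross omega u) v].
Proof.
move=> su sv.
have [w [w0 wu wv]] : exists w : 'rV[R]_3, [/\ w != 0, dot w u = 0 & dot w v = 0].
  (* A kernel vector of a 3 by 2 matrix exists even for [v = u] or [v = - u], where the cross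
     product of [u] and [v] vanishes. *)
  pose A : 'M[R]_(3, 1 + 1) := row_mx u^T v^T.
  have : kermx A != 0.
    rewrite -mxrank_eq0 mxrank_ker subn_eq0 -ltnNge.
    by apply: leq_ltn_trans (rank_leq_col A) _.
  move=> /rowV0Pn[w /sub_kermxP + w0]; rewrite /A mul_mx_row => /eqP.
  rewrite row_mx_eq0 => /andP[/eqP wu /eqP wv]; exists w; split=> //.
  - by move/matrixP/(_ 0 0): wu; rewrite !mxE => <-; apply: eq_bigr => i _; rewrite mxE.
  - by move/matrixP/(_ 0 0): wv; rewrite !mxE => <-; apply: eq_bigr => i _; rewrite mxE.
have ww : 0 < dot w w.
  rewrite lt0r; apply/andP; split; last by apply: sumr_ge0 => i _; rewrite -expr2 sqr_ge0.
  apply: contra w0 => /eqP; rewrite /dot => /psumr_eq0P ww0.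
  apply/eqP/rowP => i; rewrite mxE; apply/eqP; rewrite -sqrf_eq0 expr2 ww0 // => j _.
  by rewrite -expr2 sqr_ge0.
pose k := (Num.sqrt (dot w w))^-1.
have kk : k ^+ 2 * dot w w = 1.
  by rewrite exprVn sqr_sqrtr ?ltW // mulVf // gt_eqF.
have Z l x : dot (l *: w) x = l * dot w x by rewrite dotC dotZr dotC.
have fl l : l ^+ 2 * dot w w = 1 -> flag (l *: w) u.
  by move=> l1; do !split=> //; rewrite ?Z ?wu ?mulr0 // /sphere /= Z dotZr mulrA.
have [k0|k0] := leP 0 (dot (cross (k *: w) u) v).
  by exists (k *: w); split=> //; [apply: fl | rewrite Z wv mulr0].
(* Reversing the pole reverses the orientation of the circle and so flips the sign. *)
exists (- k *: w); split; first by apply: fl; rewrite sqrrN.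
  by rewrite Z wv mulr0.
move: k0; rewrite !(dotE, crossE) !mxE; lra.
Qed.

Lemma circle_through {R : realType} {u v : 'rV[R]_3} : sphere u -> sphere v ->
  exists omega t, [/\ flag omega u, 0 <= t <= pi & v = circle_pt omega u t].
Proof.
move=> su sv; have [omega [fl ov s0]] := flag_through su sv.
have dec := flag_decomposition fl ov.
have [cc uc _] := flag_cross fl.
have cs1 : dot u v ^+ 2 + dot (cross omega u) v ^+ 2 = 1.
  have : dot v v = 1 by [].
  by rewrite {1}dec dotC dotZDr (dotC v) (dotC v) -!expr2.
have c1 : -1 <= dot u v <= 1 by apply/andP; split; nra.
exists omega, (acos (dot u v)); split=> //; first by rewrite acos_ge0 ?acos_lepi.
rewrite /circle_pt acosK // sin_acos // -cs1 addrAC subrr add0r sqrtr_sqr.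
by rewrite ger0_norm.
Qed.

(** * Comparison with a tangent linear function *)

(** The equation is stated with derivatives at angle 0 only; moving the origin of the angle yields
    it at every [s]. *)
Lemma derive1n2_circle_pt {R : realType} {H : 'rV[R]_3 -> R}
    {omega phi : 'rV[R]_3} (s : R) : flag omega phi ->
  derive1n 2 (fun t => H (circle_pt omega phi t)) s =
  derive1n 2 (fun t => H (circle_pt omega (circle_pt omega phi s) t)) 0.
Proof.
move=> fl; under [in RHS]eq_fun do rewrite (circle_ptD _ _ fl).
rewrite /derive1n /= (derive1_shift (fun t => H (circle_pt omega phi t))).
by rewrite (derive1_shift (derive1 _)) addr0.
Qed.

(** Serves twice: for a solution, where the left side of the equation is [F], and for a difference
    of solutions, where it is 0. *)
Lemma tangent_vector_below {R : realType} {D : 'rV[R]_3 -> R} {u y : 'rV[R]_3} :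
  twice_derivable_circles D ->
  (forall omega phi, flag omega phi ->
     0 <= D phi + derive1n 2 (fun t => D (circle_pt omega phi t)) 0) ->
  sphere u -> tangent_vector D u y ->
  forall v, sphere v -> dot v y <= D v.
Proof.
move=> dD D0 su [uy Dy] v sv.
have [omega [t [fl t0 ->]]] := circle_through su sv.
have := @sturm_comparison R (fun s => D (circle_pt omega u s)) t.
rewrite circle_pt0 -uy Dy // dot_circle_pt; apply=> // s.
- exact: (dD _ _ fl s).1.
- exact: (dD _ _ fl s).2.
- by rewrite derive1n2_circle_pt //; apply/D0/circle_pt_flag.
Qed.

(** * Differences of two solutions *)

Section Difference.
Context {R : realType} {G H : 'rV[R]_3 -> R}.
Hypotheses (dG : twice_derivable_circles G) (dH : twice_derivable_circles H).

Let derive1_circle_subr omega phi : flag omega phi ->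
  derive1 (fun s => G (circle_pt omega phi s) - H (circle_pt omega phi s)) =
  derive1 (fun s => G (circle_pt omega phi s)) - derive1 (fun s => H (circle_pt omega phi s)).
Proof.
move=> fl; apply/funext => t.
rewrite [LHS]derive1E deriveB; [|exact: (dG _ _ fl t).1|exact: (dH _ _ fl t).1].
by rewrite -!derive1E.
Qed.

Lemma twice_derivable_circles_subr :
  twice_derivable_circles (fun x => G x - H x).
Proof.
move=> omega phi fl t; split.
  exact: derivableB (dG _ _ fl t).1 (dH _ _ fl t).1.
rewrite derive1_circle_subr //.
exact: derivableB (dG _ _ fl t).2 (dH _ _ fl t).2.
Qed.

Lemma derive1n2_circle_subr omega phi t : flag omega phi ->
  derive1n 2 (fun s => G (circle_pt omega phi s) - H (circle_pt omega phi s)) t =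
  derive1n 2 (fun s => G (circle_pt omega phi s)) t
  - derive1n 2 (fun s => H (circle_pt omega phi s)) t.
Proof.
move=> fl; rewrite /derive1n /= derive1_circle_subr // derive1E deriveB.
- by rewrite -!derive1E.
- exact: (dG _ _ fl t).2.
- exact: (dH _ _ fl t).2.
Qed.

Lemma tangent_vector_subr u y z : tangent_vector G u y -> tangent_vector H u z ->
  tangent_vector (fun x => G x - H x) u (y - z).
Proof.
move=> [gu gy] [hu hz]; split=> [|omega fl]; first by rewrite dotBr gu hu.
by rewrite derive1_circle_subr // dotBr -gy // -hz.
Qed.

End Difference.

(** [G - H] solves the homogeneous equation and has tangent vector [y - z] at [u]. Exchanging [G]
    and [H] gives the opposite inequality. *)
Lemma spherical_solution_ge {R : realType} {F : 'rV[R]_3 -> 'rV[R]_3 -> R}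
    {G H : 'rV[R]_3 -> R} {u y z : 'rV[R]_3} :
  spherical_solution F G -> spherical_solution F H -> sphere u ->
  tangent_vector G u y -> tangent_vector H u z ->
  forall v, sphere v -> H v + dot v (y - z) <= G v.
Proof.
move=> [/C2_sphere_circles dG GF] [/C2_sphere_circles dH HF] su Gy Hz v sv.
rewrite addrC -lerBrDr.
apply: (tangent_vector_below (twice_derivable_circles_subr dG dH) _ su) => //.
  move=> omega phi fl; rewrite (derive1n2_circle_subr dG dH) //.
  by rewrite addrACA -opprD GF // HF // subrr.
exact: tangent_vector_subr.
Qed.

(** * The body cut out by the half-spaces *)

Lemma dot_continuous {R : realType} (u : 'rV[R]_3) : continuous (dot u).
Proof.
apply: continuous_big => [|i _ x]; first exact: add_continuous.
by apply: (@continuousM R _ (cst (u 0 i))); [exact: cst_continuous | exact: coord_continuous].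
Qed.

(** The Wulff shape of [H]. *)
Definition support_body {R : realType} (H : 'rV[R]_3 -> R) : set 'rV[R]_3 :=
  [set y | forall u, sphere u -> dot u y <= H u].

Lemma closed_support_body {R : realType} (H : 'rV[R]_3 -> R) : closed (support_body H).
Proof.
have -> : support_body H = \bigcap_(u in sphere) (dot u @^-1` [set r | r <= H u]) by [].
apply: closed_bigI => u _; apply: closed_comp; last exact: closed_le.
by move=> x _; apply: dot_continuous.
Qed.

Lemma compact_support_body {R : realType} (H : 'rV[R]_3 -> R) : compact (support_body H).
Proof.
pose e (i : 'I_3) : 'rV[R]_3 := delta_mx 0 i.
have ey i (y : 'rV[R]_3) : dot (e i) y = y 0 i.
  rewrite /dot (bigD1 i) //= big1 ?addr0 => [|j ji]; rewrite !mxE ?eqxx ?mul1r //.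
  by rewrite (negbTE ji) mul0r.
have Ney i (y : 'rV[R]_3) : dot (- e i) y = - y 0 i by rewrite -ey !dotE !mxE; ring.
have se i : sphere (e i) by rewrite /sphere /= ey !mxE !eqxx.
have sNe i : sphere (- e i) by rewrite /sphere /= Ney !mxE !eqxx opprK.
(* The directions [e i] and [- e i] confine each coordinate to a segment, so the body is closed in a
   compact box. *)
apply: (subclosed_compact (closed_support_body H)
  (rV_compact (fun i => @segment_compact R (- H (- e i)) (H (e i))))).
move=> y By i /=; rewrite in_itv /= -ey By // andbT lerNl ey -Ney; exact: By.
Qed.

Lemma convex_support_body {R : realType} (H : 'rV[R]_3 -> R) : convex_set (support_body H).
Proof.
move=> x y l; rewrite !inE => xB yB u su.
have -> : dot u (conv l x y) = l%:num * dot u x + (1 - l%:num) * dot u y.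
  by rewrite -dotZDr.
have -> : H u = l%:num * H u + (1 - l%:num) * H u by ring.
have l0 : 0 <= l%:num by [].
have l1 : l%:num <= 1 by [].
by apply: lerD; apply: ler_wpM2l; rewrite ?subr_ge0 //; [apply: xB|apply: yB].
Qed.

(** * Translates and projections *)

Lemma support_translate {R : realType} {B : set 'rV[R]_3} {H : 'rV[R]_3 -> R} a :
  is_support_function B H ->
  is_support_function (translate a B) (fun u => H u + dot a u).
Proof.
move=> BH u su; have [[y By yu] ub] := BH _ su; split.
  by exists (y + a); [exists y | rewrite dotDr yu (dotC a)].
move=> _ [_ [z Bz <-] <-]; rewrite dotDr (dotC a) lerD2r.
by apply: ub; exists z.
Qed.

(** Projection removes a multiple of [omega], which is orthogonal to the circle; hence the projected
    body has the restriction of [H] as support function. *)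
Lemma dot_circle_proj {R : realType} {omega phi : 'rV[R]_3} (y : 'rV[R]_3) t :
  flag omega phi ->
  dot (circle_pt omega phi t) (Defs.proj omega y) = dot (circle_pt omega phi t) y.
Proof.
move=> fl; have [_ [_ oc]] := circle_pt_flag t fl.
by rewrite dotBr dotZr (dotC _ omega) oc mulr0 subr0.
Qed.

Lemma projection_curvature_radius {R : realType} {F : 'rV[R]_3 -> 'rV[R]_3 -> R}
    {H : 'rV[R]_3 -> R} {B : set 'rV[R]_3} :
  spherical_solution F H -> is_support_function B H ->
  is_projection_curvature_radius B F.
Proof.
move=> [/C2_sphere_circles dH HF] BH omega phi fl.
rewrite -(HF _ _ fl) -[X in H X](circle_pt0 omega).
apply: (curvature_radius_support (h := fun t => H (circle_pt omega phi t)) fl).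
- move=> _ [y _ <-].
  by case: fl => oo _; rewrite dotBr dotZr oo mulr1 subrr.
- move=> t; have [_ [st _]] := circle_pt_flag t fl.
  have [[y By yt] ub] := BH _ st; split.
    by exists (Defs.proj omega y); [exists y | rewrite dot_circle_proj].
  move=> _ [_ [z Bz <-] <-]; rewrite dot_circle_proj //.
  by apply: ub; exists z.
- by move=> t; exact: (dH _ _ fl t).1.
- exact: (dH _ _ fl 0).2.
Qed.

(** * Existence of the body and uniqueness up to translation *)

Theorem theorem1p1 (R : realType) (F : 'rV[R]_3 -> 'rV[R]_3 -> R)
    (F_ge0 : forall omega phi : 'rV[R]_3, flag omega phi -> 0 <= F omega phi)
    (H : 'rV[R]_3 -> R) (H_sol : spherical_solution F H) :
  exists B : set 'rV[R]_3,
    [/\ convex_body B,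
        is_projection_curvature_radius B F,
        is_support_function B H,
        (forall G : 'rV[R]_3 -> R, spherical_solution F G ->
           exists a : 'rV[R]_3, forall Omega : 'rV[R]_3,
             sphere Omega -> G Omega = H Omega + dot a Omega) &
        (forall a : 'rV[R]_3,
           is_support_function (translate a B)
             (fun Omega : 'rV[R]_3 => H Omega + dot a Omega))].
Proof.
have [CH HF] := H_sol.
have suppH : is_support_function (support_body H) H.
  move=> u su; have [y yu] := C2_sphere_tangent CH su.
  (* The tangent vector at [u] satisfies all the constraints and attains the one for [u]. *)
  have By : support_body H y.
    apply: (tangent_vector_below (C2_sphere_circles CH) _ su yu) => omega phi fl.
    by rewrite HF //; apply: F_ge0.
  by split; [exists y => //; case: yu | move=> _ [z Bz <-]; apply: Bz].
have [e se] : exists e : 'rV[R]_3, sphere e.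
  exists (delta_mx 0 0); rewrite /sphere /= dotE !mxE !eqxx /=; lra.
exists (support_body H); split=> //.
- split; [|exact: compact_support_body|exact: convex_support_body].
  by have [[y By _] _] := suppH _ se; exists y.
- exact: projection_curvature_radius H_sol suppH.
- move=> G G_sol; have [y Hy] := C2_sphere_tangent CH se.
  have [z Gz] := C2_sphere_tangent G_sol.1 se.
  (* The translation is read off at the single point [e], as the difference of the tangent vectors
     of [G] and [H]; the two comparisons extend it to the whole sphere. *)
  exists (z - y) => u su.
  have lo := spherical_solution_ge G_sol H_sol se Gz Hy _ su.
  have up := spherical_solution_ge H_sol G_sol se Hy Gz _ su.
  apply/eqP; rewrite eq_le dotC lo andbT -lerBlDr.
  by apply: le_trans up; rewrite !dotBr opprB.
- by move=> a; apply: support_translate.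
Qed.
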